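(* Let $K$ be a field and let $I\subset S=K[x_1,\ldots,x_n]$ be a monomial ideal which is generically a complete intersection, and suppose that $I=\bigcap_{l=1}^m\mathfrak m^{\mathbf a_l}$ (with $m\ge 1$ and nonzero vectors $\mathbf a_l=(a_{l1},\ldots,a_{ln})\in\mathbb N^n$) is the canonical irredundant primary decomposition of $I$, so that the components $\mathfrak m^{\mathbf a_l}$ have pairwise distinct radicals. Then \[ d(\overline{A(I)})\leq\frac{(n+1)!}{2}\,d^{\,n(n-1)},\qquad\text{where } d=\max_{i,l}\{a_{li}\}. \]
   Context: $\mathbb N$ is the set of non-negative integers. For a nonzero vector $\mathbf a=(a_1,\ldots,a_n)\in\mathbb N^n$, $\operatorname{supp}(\mathbf a)=\{i: a_i\ne0\}$ and $\mathfrak m^{\mathbf a}=(x_i^{a_i}: i\in\operatorname{supp}(\mathbf a))$. An ideal is generically a complete intersection if its localization at each minimal prime is a complete intersection. Symbolic powers: a monomial ideal $I\subset S$ has a unique irredundant presentation as an intersection of irreducible monomial ideals (ideals of the form $\mathfrak m^{\mathbf a}$). Intersecting those components having the same radical gives the canonical primary decomposition $I=\bigcap_i Q_i$ with pairwise distinct radicals, and the $k$th symbolic power of $I$ is $I^{(k)}=\bigcap_i Q_i^k$. In the situation of the claim, $I^{(k)}=\bigcap_{l=1}^m(\mathfrak m^{\mathbf a_l})^k$. The symbolic power algebra is $A(I)=\bigoplus_{k\ge0}I^{(k)}t^k\subset S[t]$, graded by the exponent of $t$, and $\overline{A(I)}$ is its integral closure (in its field of fractions; it is contained in $S[t]$),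 with the grading by the exponent of $t$, so its degree-$0$ component is $S$. For a finitely generated graded $S$-algebra $A$, $d(A)$ denotes the highest degree of the minimal generators of $A$ as an $S$-algebra, i.e. the smallest integer $d$ such that $A$ is generated over $S$ by homogeneous elements of degree at most $d$. *)

(* Defs.v *)
From HB Require Import structures.
From mathcomp Require Import all_boot all_order all_algebra.
From mathcomp Require Export mpoly.

Set Implicit Arguments.
Unset Strict Implicit.
Unset Printing Implicit Defensive.

Import GRing.Theory.
Local Open Scope ring_scope.
Local Notation "x %:F" := (tofrac x).

(* Subsets (ideals, subrings) are Prop-valued predicates, since membership in
   them is not decidable in general. *)
Definition included (T : Type) (A B : T -> Prop) : Prop := forall x, A x -> B x.
Definition same_set (T : Type) (A B : T -> Prop) : Prop := forall x, A x <-> B x.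

Section Ideals.
Variable R : comNzRingType.
Implicit Types (A B G J P : R -> Prop).

(* For a subring B of R, the B-submodule of R spanned by G; it is the ideal
   (G)B of B when G is contained in B. *)
Definition span B G (f : R) : Prop :=
  exists (r : nat) (c g : 'I_r -> R),
    (forall i, B (c i)) /\ (forall i, G (g i)) /\ f = \sum_(i < r) c i * g i.

Definition ideal_gen G : R -> Prop := span (fun _ => True) G.

Definition is_ideal J : Prop :=
  J 0 /\ (forall f g, J f -> J g -> J (f + g)) /\ (forall c f, J f -> J (c * f)).

Definition is_prime P : Prop :=
  is_ideal P /\ ~ P 1 /\ (forall f g, P (f * g) -> P f \/ P g).

Definition minimal_prime J P : Prop :=
  is_prime P /\ included J P /\
  (forall P', is_prime P' -> included J P' -> included P' P -> included P P').

Definition radical J (f : R) : Prop := exists k : nat, J (f ^+ k).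

Definition ideal_pow J (k : nat) : R -> Prop :=
  ideal_gen (fun f => exists g : 'I_k -> R,
    (forall i, J (g i)) /\ f = \prod_(i < k) g i).

(* Here B is a subring of R and the sequence is B-regular, including the
   requirement that it does not generate the unit ideal of B. *)
Definition regular_sequence B (r : nat) (f : 'I_r -> R) : Prop :=
  (forall i, B (f i)) /\
  (forall (i : 'I_r) y, B y ->
     let Ji := span B (fun g => exists2 j : 'I_r, (j < i)%N & g = f j) in
     Ji (f i * y) -> Ji y) /\
  ~ span B (fun g => exists j, g = f j) 1.

Definition complete_intersection B J : Prop :=
  exists (r : nat) (f : 'I_r -> R),
    regular_sequence B f /\ same_set J (span B (fun g => exists j, g = f j)).

End Ideals.

Section Fractions.
Variable R : idomainType.
Implicit Types (A J P : R -> Prop).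

(* Inside Frac(R), the extension J R_P of J; R_P itself for J = R. *)
Definition localize P J (u : {fraction R}) : Prop :=
  exists f s, J f /\ ~ P s /\ u = f%:F / s%:F.

Definition generically_ci J : Prop :=
  forall P, minimal_prime J P ->
    complete_intersection (localize P (fun _ => True)) (localize P J).

(* The field of fractions of a subring A of R, inside Frac(R). *)
Definition fraction_field_of A (u : {fraction R}) : Prop :=
  exists f g, A f /\ A g /\ g != 0 /\ u = f%:F / g%:F.

Definition integral_over A (u : {fraction R}) : Prop :=
  exists p : {poly {fraction R}},
    p \is monic /\ (forall i, exists2 f, A f & p`_i = f%:F) /\ root p u.

Definition integral_closure A (u : {fraction R}) : Prop :=
  fraction_field_of A u /\ integral_over A u.

End Fractions.

Section Graded.
Variable R : idomainType.
Local Notation L := {fraction {poly R}}.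
Implicit Types (A G : L -> Prop).

Definition homogeneous (k : nat) (u : L) : Prop :=
  exists c : R, u = (c *: 'X^k)%:F.

(* The R-subalgebra of Frac(R[t]) generated by G; closure under opposites
   comes from the constant -1. *)
Definition subalgebra_gen G (u : L) : Prop :=
  forall B : L -> Prop,
    (forall c : R, B (c%:P)%:F) -> included G B ->
    (forall v w, B v -> B w -> B (v + w)) ->
    (forall v w, B v -> B w -> B (v * w)) -> B u.

(* For an R-subalgebra A, the other inclusion is automatic. *)
Definition generated_in_degree A (d : nat) : Prop :=
  included A (subalgebra_gen (fun v => A v /\ exists2 k, (k <= d)%N & homogeneous k v)).

(* The relation "d(A) = d". *)
Definition is_generation_degree A (d : nat) : Prop :=
  generated_in_degree A d /\
  (forall d', generated_in_degree A d' -> (d <= d')%N).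

End Graded.

Section Monomial.
Variables (K : fieldType) (n : nat).
Local Notation S := {mpoly K[n]}.
Implicit Types (I J : S -> Prop).

Definition monomial_ideal I : Prop :=
  exists E : 'X_{1..n} -> Prop,
    same_set I (ideal_gen (fun f => exists2 u, E u & f = 'X_[u])).

(* The ideal m^a; for a = 0 this is the zero ideal. *)
Definition irreducible_ideal (a : 'X_{1..n}) : S -> Prop :=
  ideal_gen (fun f => exists2 i : 'I_n, a i != 0%N & f = 'X_i ^+ a i).

Definition irredundant_presentation I (r : nat) (b : 'I_r -> 'X_{1..n}) : Prop :=
  same_set I (fun f => forall j, irreducible_ideal (b j) f) /\
  (forall j, ~ same_set I
     (fun f => forall j', j' != j -> irreducible_ideal (b j') f)).

Definition same_radical (a b : 'X_{1..n}) : Prop :=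
  same_set (radical (irreducible_ideal a)) (radical (irreducible_ideal b)).

(* The intersection of the components with the same radical as the j-th one. *)
Definition primary_component (r : nat) (b : 'I_r -> 'X_{1..n}) (j : 'I_r) : S -> Prop :=
  fun f => forall j', same_radical (b j') (b j) -> irreducible_ideal (b j') f.

(* The irredundant presentation is unique up to order, so it does not matter
   which b is used; each Q_i occurs once per irreducible component of I with
   that radical, which does not change the intersection. *)
Definition symbolic_power I (k : nat) (f : S) : Prop :=
  exists (r : nat) (b : 'I_r -> 'X_{1..n}),
    irredundant_presentation I b /\
    (forall j, ideal_pow (primary_component b j) k f).

Definition symbolic_algebra I (p : {poly S}) : Prop :=
  forall k, symbolic_power I k p`_k.

(* An irredundant primary decomposition by ideals m^a is the canonical one
   when the radicals of the components are pairwise distinct. *)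
Definition canonical_decomposition I (m : nat) (a : 'I_m -> 'X_{1..n}) : Prop :=
  irredundant_presentation I a /\
  (forall l l', l != l' -> ~ same_radical (a l) (a l')).

End Monomial.

(* Main.v *)
(* With weights w_l(x^u) = sum of u_i / a_li over the support of a_l, every
   element of A(I) has all its monomials x^u t^k in the cone w_l(x^u) >= k,
   and a multiple of each lattice point of the cone lies in A(I).  Integral
   elements f/g satisfy h f^k = q_k g^k with a fixed h <> 0 and all q_k supported
   in the cone; comparing leading terms for all k shows that the leading term of
   g divides that of f with a quotient in the cone, so f/g is found by long
   division.  Hence the integral closure is spanned by the lattice points (u, k)
   of the cone.  By Caratheodory such a point dominates mu (p, 1) for a vertex p
   of the slice k = 1 and some mu >= k / n; by Cramer's rule D (p, 1) is integral,
   where D is a minor with nonnegative entries at most d^(n-1), so that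
   n D <= (n+1)!/2 d^(n(n-1)), only half of the permutations contributing with
   each sign.  For larger k we get D < mu, and D (p, 1) splits off from (u, k). *)
Require Import Defs.
From mathcomp Require Import all_boot all_order all_algebra.
From mathcomp Require Import perm alt.
From mathcomp Require Import zify lra ring.
From Stdlib Require Import Classical.

Set Implicit Arguments.
Unset Strict Implicit.
Unset Printing Implicit Defensive.

(** * Rational polyhedra *)

Section Polyhedron.
Import Order.TTheory GRing.Theory Num.Theory.
Local Open Scope ring_scope.
Variables (F : realFieldType) (q n : nat) (C : 'M[F]_(q, n)) (b : 'I_q -> F).
Implicit Types (k : F) (u w p : 'cV[F]_n) (j : 'I_q).

(** The level [k] homogenizes the system: feasible pairs form a cone, and the polyhedron itself is
    its slice at [k = 1]. *)
Definition feasible k u := forall j, b j * k <= (C *m u) j 0.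
Definition tight k u j := (C *m u) j 0 == b j * k.
(** Slack rows are zeroed rather than dropped, so the size is fixed and row spaces at different
    points can be compared. *)
Definition tight_mx k u : 'M[F]_(q, n) :=
  \matrix_(j, i) (if tight k u j then C j i else 0).

Lemma mulmx_scale u s j : (C *m (s *: u)) j 0 = s * (C *m u) j 0.
Proof. by rewrite -scalemxAr mxE. Qed.

Lemma mulmx_opp u j : (C *m (- u)) j 0 = - (C *m u) j 0.
Proof. by rewrite mulmxN mxE. Qed.

Lemma mulmx_lin u s w j :
  (C *m (u + s *: w)) j 0 = (C *m u) j 0 + s * (C *m w) j 0.
Proof. by rewrite mulmxDr mxE mulmx_scale. Qed.

Lemma feasibleD k k' u u' :
  feasible k u -> feasible k' u' -> feasible (k + k') (u + u').
Proof. by move=> hu hu' j; rewrite mulmxDr mxE mulrDr lerD. Qed.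

Lemma feasibleZ c k u : 0 <= c -> feasible k u -> feasible (c * k) (c *: u).
Proof.
by move=> c0 hu j; rewrite mulmx_scale mulrCA ler_wpM2l.
Qed.

Lemma tight_mx_mulE k u w j :
  (tight_mx k u *m w) j 0 = if tight k u j then (C *m w) j 0 else 0.
Proof.
rewrite !mxE; case: ifP => tj; first by apply: eq_bigr => i _; rewrite mxE tj.
by rewrite big1 // => i _; rewrite mxE tj mul0r.
Qed.

(** The old tight rows stay among the new ones, and [w] is killed by all of them but not by row [j],
    so the row space grows strictly. *)
Lemma rank_tight_lt k u k' u' j w :
  (forall i, tight k u i -> tight k' u' i) -> tight k' u' j ->
  (forall i, tight k u i -> (C *m w) i 0 = 0) -> (C *m w) j 0 != 0 ->
  (\rank (tight_mx k u) < \rank (tight_mx k' u'))%N.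
Proof.
move=> sub tj kw njw; apply: rank_ltmx; rewrite ltmxE; apply/andP; split.
  apply/row_subP => i; have [ti|nti] := boolP (tight k u i).
    suff -> : row i (tight_mx k u) = row i (tight_mx k' u') by apply: row_sub.
    by apply/rowP => l; rewrite !mxE ti sub.
  suff -> : row i (tight_mx k u) = 0 by apply: sub0mx.
  by apply/rowP => l; rewrite !mxE (negPf nti).
apply: contra njw => /(submx_trans (row_sub j _)) /submxP [D hD].
have -> : (C *m w) j 0 = (row j (tight_mx k' u') *m w) 0 0.
  by rewrite -row_mul [RHS]mxE tight_mx_mulE tj.
rewrite hD -mulmxA; suff -> : tight_mx k u *m w = 0 by rewrite mulmx0 mxE.
apply/colP => i; rewrite tight_mx_mulE [RHS]mxE.
by case: ifP => // /kw.
Qed.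

(** Ratio test of the simplex method: along the direction [(k1, w)] the slack of a constraint falls
    at speed [rate], and the constraint with the least [slack / rate] among positive rates is hit
    first. *)
Lemma max_step k u k1 w :
  feasible k u -> (exists j, (C *m w) j 0 < b j * k1) ->
  exists s j, [/\ 0 <= s, feasible (k + s * k1) (u + s *: w),
    (C *m w) j 0 < b j * k1 & tight (k + s * k1) (u + s *: w) j].
Proof.
move=> hu [j0 hj0].
pose slack j := (C *m u) j 0 - b j * k.
pose rate j := b j * k1 - (C *m w) j 0.
have j0P : 0 < rate j0 by rewrite subr_gt0.
case: (@arg_minP _ _ _ j0 (fun j => 0 < rate j) (fun j => slack j / rate j) j0P)
  => j rj jmin.
have sl0 i : 0 <= slack i by rewrite subr_ge0.
exists (slack j / rate j), j.
have E i s : (C *m (u + s *: w)) i 0 - b i * (k + s * k1) = slack i - s * rate i.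
  rewrite mulmx_lin /slack /rate; ring.
have s0 : 0 <= slack j / rate j by rewrite divr_ge0 // ltW.
split=> //; last first.
- by rewrite /tight -subr_eq0 E divfK ?subrr // gt_eqF.
- by rewrite -subr_gt0.
move=> i; rewrite -subr_ge0 E subr_ge0.
have [ri|ri] := lerP (rate i) 0.
  by apply: le_trans (sl0 i); rewrite mulr_ge0_le0.
by rewrite -ler_pdivlMr // jmin.
Qed.

Hypothesis pointed : forall w, C *m w = 0 -> w = 0.

(** A kernel vector of the tight rows cannot be killed by all of [C], by pointedness; its sign is
    chosen so that some constraint decreases along it. *)
Lemma tight_ker k u : (\rank (tight_mx k u) < n)%N ->
  exists2 w : 'cV[F]_n, (exists j, (C *m w) j 0 < 0)
    & forall i, tight k u i -> (C *m w) i 0 = 0.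
Proof.
move=> rk; have : kermx (tight_mx k u)^T != 0.
  by rewrite -mxrank_eq0 mxrank_ker mxrank_tr -lt0n subn_gt0.
case/rowV0Pn => v /sub_kermxP vT nzv.
have kw i : tight k u i -> (C *m v^T) i 0 = 0.
  move=> ti; have : (tight_mx k u *m v^T) i 0 = 0.
    by rewrite -[tight_mx k u]trmxK -trmx_mul vT !mxE.
  by rewrite tight_mx_mulE ti.
have /negP nCv : C *m v^T != 0.
  by apply: contra nzv => /eqP /pointed /eqP; rewrite trmx_eq0.
have [/existsP[j nj]|/existsPn H] := boolP [exists j, (C *m v^T) j 0 != 0];
  last first.
  case: nCv; apply/eqP/colP => j; rewrite [RHS]mxE; apply/eqP.
  by rewrite -[_ == _]negbK H.
case: (ltrgtP ((C *m v^T) j 0) 0) nj => // hj _; first by exists v^T => //; exists j.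
exists (- v^T).
  by exists j; rewrite mulmxN mxE oppr_lt0.
by move=> i ti; rewrite mulmxN mxE kw // oppr0.
Qed.

(** [r] bounds the rank deficit. As long as the rank is not full, a move along a kernel direction
    stays in the face and makes one more independent constraint tight; at full rank, dividing by [k]
    brings the point to level 1. *)
Lemma vertex_exists r k u :
  0 < k -> feasible k u -> (n <= \rank (tight_mx k u) + r)%N ->
  exists p, [/\ feasible 1 p, \rank (tight_mx 1 p) = n
    & forall j, tight k u j -> tight 1 p j].
Proof.
move=> k0; elim: r u => [|r IH] u hu.
  rewrite addn0 => rk; exists (k^-1 *: u).
  have tE j : tight k u j = tight 1 (k^-1 *: u) j.
    rewrite /tight mulmx_scale mulr1.
    have kn0 := lt0r_neq0 k0.
    apply/eqP/eqP => h; first by rewrite h mulrC mulfK.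
    by rewrite -h mulrC mulVKf.
  have eT : tight_mx k u = tight_mx 1 (k^-1 *: u).
    by apply/matrixP => j i; rewrite !mxE tE.
  split=> [||j]; [|by apply/eqP; rewrite eqn_leq rank_leq_col -eT|by rewrite tE].
  by rewrite -(mulVf (lt0r_neq0 k0)); apply: feasibleZ; rewrite // invr_ge0 ltW.
move=> hr; case: (ltnP (\rank (tight_mx k u)) n) => [lt|ge]; last first.
  by apply: IH => //; apply: leq_trans ge (leq_addr _ _).
case: (tight_ker lt) => w [j0 hj0] kw.
have [|s [j [s0 hf hj tj]]] := @max_step k u 0 w hu.
  by exists j0; rewrite mulr0.
rewrite mulr0 addr0 in hf tj; rewrite mulr0 in hj.
have sub i : tight k u i -> tight k (u + s *: w) i.
  by move=> ti; rewrite /tight mulmx_lin kw // mulr0 addr0.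
have rk := rank_tight_lt sub tj kw (ltr0_neq0 hj).
have [|p [hp pr pt]] := IH _ hf.
  by apply: leq_trans hr _; rewrite addnS ltn_add2r.
by exists p; split=> // i /sub /pt.
Qed.

(* Caratheodory: peel off multiples of a vertex of the minimal face; each step
   makes one more independent constraint tight, so one of the at most [r]
   steps removes a vertex with weight at least [k / r]. *)
Lemma heavy_vertex r k u :
  0 < k -> feasible k u -> (n < \rank (tight_mx k u) + r)%N ->
  exists p mu, [/\ feasible 1 p, \rank (tight_mx 1 p) = n, k / r%:R <= mu,
    mu <= k & feasible (k - mu) (u - mu *: p)].
Proof.
elim: r k u => [|r IH] k u k0 hu rk.
  by move: rk; rewrite addn0 ltnNge rank_leq_col.
have [p [hp pr pt]] := vertex_exists k0 hu (ltnW rk).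
have [hk|nhk] := boolP [forall j, 0 <= (C *m (u - k *: p)) j 0].
  exists p, k; split=> //.
    by rewrite ler_pdivrMr ?ltr0n // ler_peMr ?(ltW k0) // ler1n.
  by rewrite subrr => j; rewrite mulr0; move/forallP: hk; apply.
have uE s : u - s *: p = u + s *: (- p) by rewrite scalerN.
have [j0 hj0] : exists j, (C *m (- p)) j 0 < b j * -1.
  case/forallPn: nhk => j; rewrite -ltNge uE mulmx_lin => hj; exists j.
  rewrite -subr_gt0 -(pmulr_rgt0 _ k0).
  have := hu j; lra.
have [|s [j [s0 hf hj tj]]] := max_step hu (k1 := -1) (w := - p); first by exists j0.
rewrite mulrN1 -uE in hf tj.
(* If [s >= k], then [u - k *: p] at level 0 is a convex combination of the feasible points [(k, u)]
   and [(k - s, u - s *: p)], contrary to [nhk]. *)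
have sk : s < k.
  rewrite ltNge; apply: contra nhk => ks; apply/forallP => i.
  have sp : 0 < s := lt_le_trans k0 ks.
  have := hu i; have := hf i; rewrite !uE !mulmx_lin !mulmx_opp => h2 h1.
  rewrite -(pmulr_rge0 _ sp).
  have : 0 <= (s - k) * ((C *m u) i 0 - b i * k) by rewrite mulr_ge0 ?subr_ge0.
  have : 0 <= k * ((C *m u) i 0 + s * - (C *m p) i 0 - b i * (k - s)).
    by rewrite mulr_ge0 ?subr_ge0 // ltW.
  lra.
(* Either [s] is already heavy enough, or [s < k / r.+1] and the recursive weight is at least
   [(k - s) / r > k / r.+1]. *)
have [hm|hm] := lerP (k / r.+1%:R) s.
  by exists p, s; split=> //; apply: ltW.
have k'0 : 0 < k - s by rewrite subr_gt0.
have rk' : (n < \rank (tight_mx (k - s) (u - s *: p)) + r)%N.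
  apply: leq_trans rk _; rewrite addnS ltn_add2r.
  (* Constraints tight at [u] are tight at [p], so they vanish on this vector; constraint [j] is
     tight at the new point but slack at [p], so it does not. *)
  apply: (@rank_tight_lt _ _ _ _ j (u - s *: p - (k - s) *: p)) => //.
  - move=> i ti; rewrite uE /tight mulmx_lin mulmx_opp.
    by rewrite (eqP ti) (eqP (pt _ ti)); apply/eqP; ring.
  - move=> i ti; rewrite -!scalerN !mulmx_lin mulmx_opp.
    by rewrite (eqP ti) (eqP (pt _ ti)); ring.
  move: hj; rewrite -(scalerN (k - s)) mulmx_lin (eqP tj) mulmx_opp => hj.
  by apply: ltr0_neq0; nra.
have [p' [mu [hp' pr' hmu muk hf']]] := IH _ _ k'0 hf rk'.
exists p', mu; split=> //.
- have r0 : (0 < r)%N.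
    by case: (r) rk' => //; rewrite addn0 ltnNge rank_leq_col.
  move: hmu hm; rewrite ler_pdivrMr ?ltr0n // ltr_pdivlMr ?ltr0n //.
  rewrite ler_pdivrMr ?ltr0n // -natr1.
  have r0' : 0 < r%:R :> F by rewrite ltr0n.
  move=> h1 h2; have : s < mu by rewrite -(ltr_pM2r r0'); lra.
  lra.
- by apply: le_trans muk _; rewrite gerBl.
(* Only [p'] is removed in the end, so the portion [s] of [p] is returned to the remainder. *)
have -> : k - mu = (k - s - mu) + s * 1 by ring.
have -> : u - mu *: p' = (u - s *: p - mu *: p') + s *: p.
  by rewrite addrAC subrK.
by apply: feasibleD => //; apply: feasibleZ.
Qed.
End Polyhedron.

(** * Determinants of matrices with bounded nonnegative entries *)

Section Determinant.
Import Order.TTheory GRing.Theory Num.Theory.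
Local Open Scope ring_scope.

Lemma card_parity n (e : bool) :
  (1 < n)%N -> (#|[pred s : 'S_n | odd_perm s == e]| * 2 = n`!)%N.
Proof.
move=> n1; have cA : (#|[pred s : 'S_n | odd_perm s == false]| * 2 = n`!)%N.
  rewrite mulnC -[n in RHS]card_ord -card_Alt ?card_ord //; congr (_ * _)%N.
  by apply: eq_card => s; rewrite Alt_even !inE eqbF_neg.
case: e => //; have := cardC [pred s : 'S_n | odd_perm s == false].
rewrite card_Sn; set c := #|predC _|.
have -> : c = #|[pred s : 'S_n | odd_perm s == true]|.
  by apply: eq_card => s; rewrite !inE; case: odd_perm.
by move: cA; move: #|_| #|_| (n`!) => x y z; lia.
Qed.

(** With nonnegative entries the even and the odd permutations each contribute a sum between 0 and
    [n! / 2 * E ^ n], and the determinant is the difference of the two sums. *)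
Lemma absz_det_le n (M : 'M[int]_n) (E : nat) :
  (forall i j, 0 <= M i j <= E%:Z) -> (1 < n)%N ->
  (`|\det M|%N * 2 <= n`! * E ^ n)%N.
Proof.
move=> hM n1.
pose sgn_part e := \sum_(s : 'S_n | odd_perm s == e) \prod_i M i (s i).
have sgn_bd e : 0 <= sgn_part e /\ sgn_part e * 2 <= (n`! * E ^ n)%:Z.
  have pbd (s : 'S_n) : 0 <= \prod_i M i (s i) <= (E ^ n)%:Z.
    apply/andP; split; first by apply: prodr_ge0 => i _; case/andP: (hM i (s i)).
    have -> : (E ^ n)%:Z = \prod_(i < n) E%:Z.
      by rewrite prodr_const card_ord -!natz natrX.
    by apply: ler_prod => i _; apply: hM.
  split; first by apply: sumr_ge0 => s _; case/andP: (pbd s).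
  rewrite -(card_parity e n1) mulnAC PoszM ler_wpM2r //.
  have -> : (#|[pred s : 'S_n | odd_perm s == e]| * E ^ n)%:Z
      = \sum_(s : 'S_n | odd_perm s == e) (E ^ n)%:Z.
    by rewrite sumr_const -mulr_natl PoszM natz.
  by apply: ler_sum => s _; case/andP: (pbd s).
have -> : \det M = sgn_part false - sgn_part true.
  rewrite /determinant (bigID (fun s : 'S_n => odd_perm s == false)) /=.
  congr (_ + _); first by apply: eq_bigr => s /eqP ->; rewrite expr0 mul1r.
  rewrite -sumrN; apply: eq_big => [s|s]; case: odd_perm => // _.
  by rewrite expr1 mulN1r.
have [] := sgn_bd false; have [] := sgn_bd true.
move: (sgn_part _) (sgn_part _) (n`! * E ^ n)%N => x y N; lia.
Qed.

(** The halving needs at least two rows, so sizes 0 and 1 are settled directly; beyond that,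
    [n * n! / 2] is at most [(n + 1)! / 2]. *)
Lemma mul_absz_det_le n (M : 'M[int]_n) (E : nat) :
  (forall i j, 0 <= M i j <= E%:Z) ->
  (n * `|\det M|%N <= (n.+1)`! %/ 2 * E ^ n)%N.
Proof.
case: n M => [|[|n]] M hM //.
  have -> : (2`! %/ 2 = 1)%N by [].
  by rewrite det_mx11 mul1n expn1 mul1n; case/andP: (hM 0 0); move: (M 0 0) => x; lia.
have := absz_det_le hM isT; rewrite (factS n.+2).
have -> : (n.+3 * n.+2`! %/ 2 = n.+3 * (n.+2`! %/ 2))%N.
  by rewrite muln_divA // dvdn_fact.
have : (n.+2`! %/ 2 * 2 = n.+2`!)%N by rewrite divnK // dvdn_fact.
set a := (_ %/ 2)%N; set x := (E ^ _)%N => <- h.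
have {h} : (`|\det M|%N <= a * x)%N by lia.
rewrite -mulnA; move: (a * x)%N => y; nia.
Qed.

End Determinant.

(** * Clearing the denominators of a vertex *)

Section LatticePoints.
Import Order.TTheory GRing.Theory Num.Theory.
Local Open Scope ring_scope.

(** Cramer's rule: [n] independent tight rows form an invertible integral system for [p], and the
    adjugate turns its right-hand side into [\det M] times [p]. The sign factor makes the multiplier
    positive. *)
Lemma vertex_integral q n (C : 'M[int]_(q, n)) (b : 'cV[int]_q)
    (p : 'cV[rat]_n) :
  \rank (tight_mx (map_mx intr C) (fun j => (b j 0)%:~R) 1 p) = n ->
  exists f : 'I_n -> 'I_q, \det (rowsub f C) != 0 /\
    exists v : 'cV[int]_n, map_mx intr v = (`|\det (rowsub f C)|)%:~R *: p.
Proof.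
set T := tight_mx _ _ _ _ => rk.
have full : row_full T by rewrite /row_full rk.
pose f := fullrankfun full; exists f.
(* A slack row would be a zero row of the selected submatrix, and the unit vector at [i] would lie
   in its trivial kernel. *)
have tf i : tight (map_mx intr C) (fun j => (b j 0)%:~R) 1 p (f i).
  apply: contraT => nt; have := fullrowsub_free full; rewrite -kermx_eq0 => k0.
  suff : kermx (rowsub f T) != 0 by rewrite k0.
  apply/rowV0Pn.
  exists (delta_mx 0 i); last first.
    by apply/negP => /eqP/matrixP/(_ 0 i); rewrite !mxE !eqxx.
  apply/sub_kermxP; rewrite -rowE; apply/rowP => j.
  by rewrite !mxE (negPf nt).
set M := rowsub f C.
have MT : map_mx intr M = rowsub f T.
  by apply/matrixP => i j; rewrite !mxE tf.
have dM : \det M != 0.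
  have := fullrowsub_unit full; rewrite -MT unitmxE det_map_mx unitfE.
  by rewrite intr_eq0.
split=> //; exists (Num.sg (\det M) *: (\adj M *m rowsub f b)).
have Mp : map_mx intr M *m p = map_mx intr (rowsub f b).
  apply/colP => i; rewrite -[RHS]mulr1 [in RHS]mxE [in RHS]mxE.
  by rewrite -(eqP (tf i)) !mxE; apply: eq_bigr => j _; rewrite !mxE.
rewrite map_mxZ map_mxM -Mp mulmxA map_mx_adj mul_adj_mx det_map_mx.
by rewrite mul_scalar_mx scalerA -intrM normrEsg.
Qed.

End LatticePoints.

(** * Splitting lattice points of high level *)

Section LatticeDecomposition.
Import Order.TTheory GRing.Theory Num.Theory.
Local Open Scope ring_scope.
Variables (m n : nat) (c : 'I_m -> 'I_n -> nat) (r : 'I_m -> nat).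

Definition in_cone (k : nat) (u : 'I_n -> nat) :=
  forall l, (r l * k <= \sum_i c l i * u i)%N.

(** The identity block with right-hand side 0 encodes the nonnegativity of the coordinates; it also
    makes the system pointed. *)
Let C : 'M[int]_(m + n, n) := col_mx (\matrix_(l, i) (c l i)%:Z) 1%:M.
Let b : 'cV[int]_(m + n) := col_mx (\col_l (r l)%:Z) 0.
Let CQ : 'M[rat]_(m + n, n) := map_mx intr C.
Let bQ j : rat := (b j 0)%:~R.
Notation feas := (feasible CQ bQ).

Lemma CQ_lshift (u : 'cV[rat]_n) l :
  (CQ *m u) (lshift n l) 0 = \sum_i (c l i)%:R * u i 0.
Proof.
rewrite mxE; apply: eq_bigr => i _.
by rewrite mxE col_mxEu mxE -pmulrn.
Qed.

Lemma CQ_rshift (u : 'cV[rat]_n) i : (CQ *m u) (rshift m i) 0 = u i 0.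
Proof.
have -> : CQ = col_mx (map_mx intr (\matrix_(l, i) (c l i)%:Z)) 1%:M.
  by rewrite /CQ map_col_mx map_mx1.
by rewrite mul_col_mx col_mxEd mul1mx.
Qed.

Lemma feasP k (u : 'cV[rat]_n) : feas k u <->
  (forall l, (r l)%:R * k <= \sum_i (c l i)%:R * u i 0) /\
  (forall i, 0 <= u i 0).
Proof.
have bl l : bQ (lshift n l) = (r l)%:R by rewrite /bQ col_mxEu mxE -pmulrn.
have br i : bQ (rshift m i) = 0 by rewrite /bQ col_mxEd mxE.
split=> [h|[h1 h2] j].
  split=> [l|i].
    by have := h (lshift n l); rewrite bl CQ_lshift.
  by have := h (rshift m i); rewrite br CQ_rshift mul0r.
case: (split_ordP j) => i ->; first by rewrite bl CQ_lshift.
by rewrite br CQ_rshift mul0r.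
Qed.

Lemma feas_nat (k : nat) (u : 'I_n -> nat) :
  feas k%:R (\col_i (u i)%:R) <-> in_cone k u.
Proof.
have E l : (\sum_i (c l i)%:R * (\col_i (u i)%:R : 'cV[rat]_n) i 0)
    = (\sum_i c l i * u i)%N%:R.
  by rewrite natr_sum; apply: eq_bigr => i _; rewrite mxE natrM.
rewrite feasP; split=> [[h _] l|h].
  by have := h l; rewrite E -natrM ler_nat.
split=> [l|i]; first by rewrite E -natrM ler_nat.
by rewrite mxE ler0n.
Qed.

Lemma cone_decomposition (E k : nat) (u : 'I_n -> nat) :
  (0 < n)%N -> (0 < E)%N -> (forall l i, (c l i <= E)%N) ->
  in_cone k u -> ((n.+1)`! %/ 2 * E ^ n < k)%N ->
  exists k' (v w : 'I_n -> nat), [/\ (0 < k' < k)%N,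
    forall i, u i = (v i + w i)%N, in_cone k' v & in_cone (k - k') w].
Proof.
move=> n0 E0 cE cu kbig.
have pointed (w : 'cV[rat]_n) : CQ *m w = 0 -> w = 0.
  by move=> w0; apply/colP => i; rewrite -CQ_rshift w0 !mxE.
have k0 : 0 < k%:R :> rat by rewrite ltr0n; apply: leq_ltn_trans kbig.
pose uQ : 'cV[rat]_n := \col_i (u i)%:R.
have fu : feas k%:R uQ by apply/feas_nat.
pose e : 'cV[rat]_n := delta_mx (Ordinal n0) 0.
(* Lowering one coordinate until a constraint is tight gains one rank, hence
   the factor [n] instead of [n + 1] below. *)
have [|s [j [s0 fu' hj tj]]] := max_step fu (k1 := 0) (w := - e).
  exists (rshift m (Ordinal n0)).
  by rewrite CQ_rshift mulr0 !mxE !eqxx oppr_lt0.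
rewrite mulr0 addr0 in fu' tj; rewrite mulr0 in hj; set u' := uQ + _ in fu' tj.
(* The tight row [j] is nonzero, since constraint [j] strictly decreases along [- e]; hence the rank
   is at least 1. *)
have rk : (n < \rank (tight_mx CQ bQ k%:R u') + n)%N.
  rewrite -[X in (X < _)%N]add0n ltn_add2r lt0n mxrank_eq0.
  apply: contraL hj => /eqP T0; rewrite -leNgt.
  have := tight_mx_mulE CQ bQ k%:R u' (- e) j.
  by rewrite T0 mul0mx mxE tj => <-.
have [p [mu [fp rp hmu muk fr]]] := heavy_vertex pointed k0 fu' rk.
have [f [dM [v vE]]] := vertex_integral rp.
set M := rowsub f C in dM vE; pose D := `|\det M|%N.
have D0 : (0 < D)%N by rewrite absz_gt0.
(* Rows of [M] are either rows of [c], bounded by [E], or unit vectors, bounded by 1 and so by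
   [E]. *)
have hD : (n * D <= (n.+1)`! %/ 2 * E ^ n)%N.
  apply: mul_absz_det_le => i l; rewrite mxE; case: (split_ordP (f i)) => i' ->.
    by rewrite col_mxEu mxE lez_nat cE.
  by rewrite col_mxEd mxE; case: eqP => //= _; rewrite lez_nat.
(* The lower bound on [k] gives [n * D < k], and [mu] is at least [k / n]. *)
have Dmu : D%:R < mu.
  apply: lt_le_trans hmu; rewrite ltr_pdivlMr ?ltr0n // -natrM ltr_nat mulnC.
  exact: leq_ltn_trans kbig.
have Dk : (D < k)%N by rewrite -(ltr_nat rat); apply: lt_le_trans muk.
have vE' : map_mx intr v = D%:R *: p by rewrite vE /D pmulrn abszE.
have fv : feas D%:R (map_mx intr v).
  by rewrite vE' -[X in feas X]mulr1; apply: feasibleZ fp; rewrite ler0n.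
have fw : feas (k - D)%:R (uQ - map_mx intr v).
  have -> : (k - D)%:R = (k%:R - mu) + (mu - D%:R) * 1 + 0.
    by rewrite natrB ?(ltnW Dk) //; ring.
  have -> : uQ - map_mx intr v = (u' - mu *: p) + (mu - D%:R) *: p + s *: e.
    rewrite vE' /u' scalerN scalerBl; apply/colP => i; rewrite !mxE; ring.
  apply: feasibleD; first apply: feasibleD => //.
    by apply: feasibleZ => //; rewrite subr_ge0 ltW.
  apply/feasP; split=> [l|i].
    rewrite mulr0; apply: sumr_ge0 => i _.
    by rewrite mulr_ge0 ?ler0n // !mxE mulr_ge0 // ler0n.
  by rewrite !mxE mulr_ge0 // ler0n.
have v0 i : 0 <= v i 0.
  by have [_ /(_ i)] := (feasP _ _).1 fv; rewrite mxE ler0z.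
have vu i : v i 0 <= (u i)%:Z.
  have [_ /(_ i)] := (feasP _ _).1 fw.
  by rewrite !mxE subr_ge0 pmulrn ler_int.
exists D, (fun i => absz (v i 0)), (fun i => (u i - absz (v i 0)%R)%N); split.
- by rewrite D0.
- by move=> i; have := v0 i; have := vu i; lia.
- apply/feas_nat; suff <- : map_mx intr v
      = (\col_i (absz (v i 0))%:R : 'cV[rat]_n) by [].
  by apply/colP => i; rewrite !mxE pmulrn gez0_abs.
apply/feas_nat.
suff <- : uQ - map_mx intr v
    = (\col_i ((u i - absz (v i 0)%R)%N)%:R : 'cV[rat]_n) by [].
apply/colP => i; rewrite !mxE natrB; last by have := v0 i; have := vu i; lia.
by rewrite [(absz _)%:R]pmulrn gez0_abs.
Qed.

End LatticeDecomposition.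

(** * Integral closure *)

Section AlmostIntegral.
Import Order.TTheory GRing.Theory.
Local Open Scope ring_scope.
Variables (R : comNzRingType) (P : R -> Prop).

(** The fraction [f / g] is almost integral over [P] with common denominator [h], expressed without
    fractions. *)
Definition almost_integral (h f g : R) :=
  forall k, exists2 q, P q & h * f ^+ k = q * g ^+ k.

Hypothesis PB : forall x y, P x -> P y -> P (x - y).
Hypothesis PM : forall x y, P x -> P y -> P (x * y).

Lemma almost_integral_sub h f g c :
  P c -> almost_integral h f g -> almost_integral h (f - c * g) g.
Proof.
move=> Pc hfg k.
(* Mixed powers allow an induction on [k] for all [j], in place of a binomial expansion. *)
suff H j : exists2 q, P q & h * f ^+ j * (f - c * g) ^+ k = q * g ^+ (j + k).
  by have [q Pq] := H 0; rewrite expr0 mulr1 add0n; exists q.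
elim: k j => [|k IH] j.
  by have [q Pq hq] := hfg j; exists q; rewrite // expr0 mulr1 addn0.
have [q1 Pq1 h1] := IH j.+1; have [q2 Pq2 h2] := IH j.
exists (q1 - c * q2); first by apply: PB => //; apply: PM.
have -> : (q1 - c * q2) * g ^+ (j + k.+1)
    = q1 * g ^+ (j.+1 + k) - c * g * (q2 * g ^+ (j + k)).
  by rewrite addSn addnS exprS; move: (g ^+ _) => y; ring.
rewrite -h1 -h2 !exprS; move: (f ^+ j) (_ ^+ k) => y z; ring.
Qed.

End AlmostIntegral.

(** * Complete integral closedness of the polynomial ring *)

Section MPolyCompletelyIntegrallyClosed.
Import Order.TTheory GRing.Theory.
Local Open Scope ring_scope.
Variables (K : fieldType) (n : nat).
Implicit Types (h f g : {mpoly K[n]}).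

Lemma mlead_mulX h f q g k : h != 0 -> f != 0 -> q != 0 -> g != 0 ->
  h * f ^+ k = q * g ^+ k ->
  (mlead h + mlead f *+ k)%MM = (mlead q + mlead g *+ k)%MM.
Proof.
move=> h0 f0 q0 g0 E; rewrite -(mleadX k f0) -(mleadX k g0).
by rewrite -(mleadM h0 (expf_neq0 k f0)) E (mleadM q0 (expf_neq0 k g0)).
Qed.

(** Long division by well-founded induction on the leading monomial: once [mlead g] divides
    [mlead f], subtracting a multiple of [g] lowers [mlead f] and preserves almost integrality. *)
Lemma mpoly_almost_integral_dvd h f g : h != 0 -> g != 0 ->
  almost_integral (fun _ => True) h f g -> exists q, f = q * g.
Proof.
move=> h0 g0; move mfE : (mlead f) => mf.
elim/(well_founded_ind (@ltom_wf n)): mf f mfE => mf IH f mfE hfg.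
have [->|f0] := eqVneq f 0; first by exists 0; rewrite mul0r.
have le : (mlead g <= mlead f)%MM.
  (* For this power, a deficit of 1 in the [i]-th exponent of [mlead f] would amount to
     [mlead h i + 1], more than [h] can supply. *)
  apply/mnm_lepP => i; have [q _ hq] := hfg (mlead h i).+1.
  have q0 : q != 0.
    apply/eqP => q0; move/eqP: hq.
    by rewrite q0 mul0r mulf_eq0 expf_eq0 (negPf h0) (negPf f0) andbF.
  have /mnmP/(_ i) := mlead_mulX h0 f0 q0 g0 hq; rewrite !mnmDE !mulmnE.
  move: (mlead f i) (mlead g i) (mlead h i) (mlead q i); clear.
  move=> x y z t E; rewrite leqNgt; apply/negP => /(leq_mul (leqnn z.+1)).
  rewrite mulnS (mulnC _ x) (mulnC _ y); lia.
pose c := (mleadc f / mleadc g) *: 'X_[mlead f - mlead g].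
have cgE : (c * g)@_(mlead f) = mleadc f.
  rewrite -{1}(submK le) /c -scalerAl mcoeffZ (mulrC _ g) mcoeffMX.
  rewrite divfK //.
  by rewrite mleadc_eq0.
have cgl : (mlead (c * g) <= mlead f)%O.
  rewrite -[X in (_ <= X)%O](submK le); apply: le_trans (mleadM_le _ _) _.
  rewrite lemc_add2l; apply: le_trans (mleadZ_le _ _) _.
  by rewrite mleadXm.
have [f'0|f'0] := eqVneq (f - c * g) 0.
  by exists c; apply/eqP; rewrite -subr_eq0 f'0.
have lt : (mlead (f - c * g) < mlead f)%O.
  rewrite lt_neqAle; apply/andP; split; last first.
    apply: le_trans (mleadB_le _ _) _.
    by rewrite leUx lexx.
  apply: contra f'0 => /eqP E; rewrite -mleadc_eq0 E mcoeffB cgE.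
  by rewrite subrr.
rewrite mfE in lt; have [|q hq] := IH _ lt _ erefl.
  by apply: almost_integral_sub.
by exists (q + c); rewrite mulrDl -hq subrK.
Qed.

End MPolyCompletelyIntegrallyClosed.

(** * Orders of polynomials for an additive weight *)

Section MonomialOrder.
Import Order.TTheory GRing.Theory.
Local Open Scope ring_scope.
Variables (K : fieldType) (n : nat) (wt : 'X_{1..n} -> nat).
Hypothesis wtD : {morph wt : u v / (u + v)%MM >-> (u + v)%N}.
Implicit Types (f g h : {mpoly K[n]}) (a b : nat).

(** A lower bound on the order rather than its value, so that the zero polynomial satisfies every
    bound. *)
Definition order_ge a f := all (fun u => (a <= wt u)%N) (msupp f).

Lemma order_geP a f :
  reflect (forall u, u \in msupp f -> (a <= wt u)%N) (order_ge a f).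
Proof. exact: allP. Qed.

Lemma order_ge_le a b f : (a <= b)%N -> order_ge b f -> order_ge a f.
Proof.
by move=> ab /order_geP hf; apply/order_geP => u /hf; apply: leq_trans.
Qed.

Lemma order_ge0 a : order_ge a 0.
Proof. by apply/order_geP => u; rewrite msupp0. Qed.

Lemma order_geD a f g : order_ge a f -> order_ge a g -> order_ge a (f + g).
Proof.
move=> /order_geP hf /order_geP hg; apply/order_geP => u /msuppD_le.
by rewrite mem_cat => /orP[/hf|/hg].
Qed.

Lemma order_geB a f g : order_ge a f -> order_ge a g -> order_ge a (f - g).
Proof.
move=> /order_geP hf /order_geP hg; apply/order_geP => u /msuppB_le.
by rewrite mem_cat => /orP[/hf|/hg].
Qed.

Lemma order_geM a b f g :
  order_ge a f -> order_ge b g -> order_ge (a + b) (f * g).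
Proof.
move=> /order_geP hf /order_geP hg; apply/order_geP => u /msuppM_le.
case/allpairsP => [[v w] /= [/hf hv /hg hw ->]].
by rewrite wtD leq_add.
Qed.

Lemma order_ge_sum a (I : Type) (s : seq I) (Q : pred I) (F : I -> {mpoly K[n]}) :
  (forall i, Q i -> order_ge a (F i)) -> order_ge a (\sum_(i <- s | Q i) F i).
Proof.
by move=> hF; elim/big_ind: _ => //; [apply: order_ge0|apply: order_geD].
Qed.

(** The weighted homogeneous component of weight [a]; it is the initial form when [f] has order
    [a]. *)
Definition initial_form a f :=
  \sum_(u <- msupp f | wt u == a) f@_u *: 'X_[u].

Lemma initial_form_supp a f u : u \in msupp (initial_form a f) -> wt u = a.
Proof.
suff /allP H : all (fun u => wt u == a) (msupp (initial_form a f)).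
  by move=> /H /eqP.
rewrite /initial_form; elim/big_ind: _ => [|f1 f2 h1 h2|v hv].
- by rewrite msupp0.
- by apply/allP => v /msuppD_le; rewrite mem_cat => /orP[/(allP h1)|/(allP h2)].
by apply/allP => w /msuppZ_le; rewrite msuppX inE => /eqP ->.
Qed.

Lemma order_ge_initial a f :
  order_ge a f -> order_ge a.+1 (f - initial_form a f).
Proof.
move=> /order_geP hf; rewrite [X in X - _]mpolyE.
rewrite (bigID (fun u => wt u == a)) /= addrC addrK big_seq_cond.
apply: order_ge_sum => u /andP[/hf hu nu]; apply/order_geP => v /msuppZ_le.
by rewrite msuppX inE => /eqP ->; rewrite ltn_neqAle eq_sym nu.
Qed.

(** The product of the two initial forms is nonzero because the ring is a domain; it has weight
    [a + b] and differs from [f * g] by terms of higher order. *)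
Lemma order_eqM a b f g : order_ge a f -> ~~ order_ge a.+1 f ->
  order_ge b g -> ~~ order_ge b.+1 g -> ~~ order_ge (a + b).+1 (f * g).
Proof.
move=> fa nfa gb ngb; set f0 := initial_form a f; set g0 := initial_form b g.
have nz0 c p : order_ge c p -> ~~ order_ge c.+1 p -> initial_form c p != 0.
  move=> pc; apply: contra => /eqP p0.
  by have := order_ge_initial pc; rewrite p0 subr0.
have f0n : f0 != 0 by apply: nz0.
have g0n : g0 != 0 by apply: nz0.
have g0b : order_ge b g0 by apply/order_geP => u /initial_form_supp ->.
apply/negP => fg.
have : order_ge (a + b).+1 (f0 * g0).
  have -> : f0 * g0 = f * g - (f - f0) * g0 - f * (g - g0) by ring.
  apply: order_geB; last by rewrite -addnS; apply: order_geM (order_ge_initial gb).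
  by apply: order_geB => //; rewrite -addSn; apply: order_geM (order_ge_initial fa) _.
move/order_geP/(_ (mlead (f0 * g0))).
have fg0 : f0 * g0 != 0 by rewrite mulf_neq0.
move/(_ (mlead_supp fg0)); have /msuppM_le := mlead_supp fg0.
case/allpairsP => [[v w] /= [/initial_form_supp hv /initial_form_supp hw ->]].
by rewrite wtD hv hw ltnn.
Qed.

Lemma order_exists f : f != 0 -> exists2 a, order_ge a f & ~~ order_ge a.+1 f.
Proof.
move=> f0; have : ~~ order_ge (wt (mlead f)).+1 f.
  by apply/negP => /order_geP /(_ _ (mlead_supp f0)); rewrite ltnn.
elim: (wt (mlead f)) => [|a IH] na.
  by exists 0%N => //; apply/order_geP.
by have [ha|/IH] := boolP (order_ge a.+1 f); [exists a.+1|].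
Qed.

(** If [f] had order [a < w] and [h] order [b], then [h * f ^+ j] would have order exactly
    [b + j * a], which is below [j * w] at [j = b + 1]. *)
Lemma almost_order_ge h f w : h != 0 ->
  (forall j, order_ge (j * w) (h * f ^+ j)) -> order_ge w f.
Proof.
move=> h0 hfw; have [->|f0] := eqVneq f 0; first exact: order_ge0.
have [a fa nfa] := order_exists f0; have [b hb nhb] := order_exists h0.
have [wa|aw] := leqP w a; first exact: order_ge_le fa.
have E j : order_ge (b + j * a) (h * f ^+ j) /\ ~~ order_ge (b + j * a).+1 (h * f ^+ j).
  elim: j => [|j [IH1 IH2]]; first by rewrite addn0 mulr1.
  by rewrite mulSnr addnA exprSr mulrA; split; [apply: order_geM|apply: order_eqM].
have [_ /negP[]] := E b.+1.
apply: order_ge_le (hfw b.+1); nia.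
Qed.

End MonomialOrder.

(** * The semigroup ring of the cone and its integral closedness *)

Section ConeAlgebra.
Import Order.TTheory GRing.Theory.
Local Open Scope ring_scope.
Local Notation "x %:F" := (tofrac x).
Variables (K : fieldType) (n m : nat) (c : 'I_m -> 'I_n -> nat) (r : 'I_m -> nat).
Local Notation S := {mpoly K[n]}.
Implicit Types (f g h p q : {poly S}) (l : 'I_m).

Definition weight l (u : 'X_{1..n}) := (\sum_i c l i * u i)%N.

Lemma weightD l : {morph weight l : u v / (u + v)%MM >-> (u + v)%N}.
Proof.
move=> u v; rewrite /weight -big_split /=; apply: eq_bigr => i _.
by rewrite mnmDE mulnDr.
Qed.

(** The span over [K] of the monomials [x^u t^k] whose exponents are lattice points of the cone. *)
Definition cone_alg p := forall l k, order_ge (weight l) (r l * k) p`_k.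

Lemma cone_algZXn (s : S) k :
  (forall l, order_ge (weight l) (r l * k) s) -> cone_alg (s *: 'X^k).
Proof.
move=> hs l j; rewrite coefZ coefXn; case: eqP => [->|_].
  by rewrite mulr1.
by rewrite mulr0 order_ge0.
Qed.

Lemma cone_alg0 : cone_alg 0.
Proof. by move=> l k; rewrite coef0 order_ge0. Qed.

Lemma cone_algB p q : cone_alg p -> cone_alg q -> cone_alg (p - q).
Proof. by move=> hp hq l k; rewrite coefB; apply: order_geB. Qed.

Lemma cone_algN p : cone_alg p -> cone_alg (- p).
Proof. by move=> hp; rewrite -sub0r; apply: cone_algB => //; apply: cone_alg0. Qed.

Lemma cone_algD p q : cone_alg p -> cone_alg q -> cone_alg (p + q).
Proof. by move=> hp hq; rewrite -[q]opprK; apply/cone_algB/cone_algN. Qed.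

Lemma cone_algM p q : cone_alg p -> cone_alg q -> cone_alg (p * q).
Proof.
move=> hp hq l k; rewrite coefM; apply: order_ge_sum => i _.
have -> : (r l * k = r l * i + r l * (k - i))%N.
  by rewrite -mulnDr subnKC // -ltnS.
by apply: order_geM (hp l i) (hq l _); apply: weightD.
Qed.

Lemma cone_algX p k : cone_alg p -> cone_alg (p ^+ k).
Proof.
move=> hp; elim: k => [|k IH]; last by rewrite exprS; apply: cone_algM.
move=> l [|k]; last by rewrite coef1 order_ge0.
by rewrite muln0; apply/order_geP.
Qed.

Lemma deg_mulX (R : idomainType) (p q : {poly R}) k : p != 0 -> q != 0 ->
  (size (p * q ^+ k)%R).-1 = ((size p).-1 + (size q).-1 * k)%N.
Proof.
move=> p0 q0; rewrite size_mul ?expf_neq0 // -size_exp.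
have : (0 < size p)%N by rewrite lt0n size_poly_eq0.
have : (0 < size (q ^+ k))%N by rewrite lt0n size_poly_eq0 expf_neq0.
by move: (size _) (size _) => x y; lia.
Qed.

Lemma size_sub_lead (R : nzRingType) (s : R) (f g : {poly R}) N : f != 0 ->
  ((size f).-1 = N + (size g).-1)%N -> lead_coef f = s * lead_coef g ->
  (size (f - s *: 'X^N * g)%R < size f)%N.
Proof.
move=> f0 df lf.
have sf : (0 < size f)%N by rewrite lt0n size_poly_eq0.
rewrite -[X in (_ < X)%N](prednK sf) ltnS; apply/leq_sizeP => j hj.
rewrite coefB -scalerAl coefZ coefXnM.
rewrite ltnNge (leq_trans (leq_addr _ _) (_ : N + (size g).-1 <= j)%N) -?df //=.
move: hj; rewrite leq_eqVlt => /predU1P[<-|hj].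
  by rewrite {2}df addKn -/(lead_coef f) lf subrr.
rewrite !nth_default ?mulr0 ?subrr //.
  by move: hj; rewrite df; move: (size g) => y; lia.
by rewrite -[X in (X <= _)%N](prednK sf).
Qed.

(** Long division in [t], by induction on [size f]; each quotient term must exist over [S] and lie
    in the cone. *)
Lemma cone_almost_integral_dvd h f g : h != 0 -> g != 0 ->
  almost_integral cone_alg h f g -> exists2 q, cone_alg q & f = q * g.
Proof.
move=> h0 g0; have [sf] := ubnP (size f); elim: sf f => // sf IH f.
rewrite ltnS => hsf hfg.
have [->|f0] := eqVneq f 0; first by exists 0; rewrite ?mul0r //; apply: cone_alg0.
have qn0 k q : h * f ^+ k = q * g ^+ k -> q != 0.
  move=> E; apply: contraTneq (mulf_neq0 h0 (expf_neq0 k f0)) => q0.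
  by rewrite E q0 mul0r eqxx.
have degE k q : h * f ^+ k = q * g ^+ k ->
    ((size h).-1 + (size f).-1 * k = (size q).-1 + (size g).-1 * k)%N.
  by move=> E; rewrite -!deg_mulX ?E // (qn0 _ _ E).
have le : ((size g).-1 <= (size f).-1)%N.
  have [q _ /degE] := hfg (size h).-1.+1.
  move: (size g).-1 (size f).-1 (size h).-1 (size q).-1; clear.
  move=> x y z t E; rewrite leqNgt; apply/negP => /(leq_mul (leqnn z.+1)).
  rewrite mulnS (mulnC _ x) (mulnC _ y); lia.
set N := ((size f).-1 - (size g).-1)%N.
have lg0 : lead_coef g != 0 by rewrite lead_coef_eq0.
have lh0 : lead_coef h != 0 by rewrite lead_coef_eq0.
have leadE k q : h * f ^+ k = q * g ^+ k ->
    lead_coef h * lead_coef f ^+ k = lead_coef q * lead_coef g ^+ k.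
  by move=> E; rewrite -!lead_coef_exp -!lead_coefM E.
(* Leading coefficients in [t] satisfy the same relations, so the polynomial case makes
   [lead_coef g] divide [lead_coef f]. *)
have [|s sE] := mpoly_almost_integral_dvd (f := lead_coef f) lh0 lg0.
  by move=> k; have [q _ /leadE E] := hfg k; exists (lead_coef q).
(* The leading coefficient of [q] is [lead_coef h * s ^+ k], and [q] has degree at least [N * k], so
   the order of this coefficient grows at least like [k] times the bound required of [s]. *)
have cs : cone_alg (s *: 'X^N).
  apply: cone_algZXn => l; apply: (almost_order_ge (weightD l) lh0) => k.
  have [q hq E] := hfg k; have := leadE _ _ E.
  rewrite sE exprMn mulrA => /(mulIf (expf_neq0 k lg0)) ->.
  apply: order_ge_le (hq l (size q).-1).
  have -> : ((size q).-1 = (size h).-1 + N * k)%N.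
    move: (degE _ _ E) (leq_mul le (leqnn k)); rewrite /N mulnBl.
    move: (_ * k)%N (_ * k)%N (size h).-1 (size q).-1; clear; lia.
  by rewrite mulnDr mulnCA (mulnC k) leq_addl.
have [|q hq E] := IH (f - s *: 'X^N * g) _
  (almost_integral_sub cone_algB cone_algM cs hfg).
  by apply: leq_trans hsf; apply: size_sub_lead; rewrite // subnK.
exists (q + s *: 'X^N); first exact: cone_algD.
by rewrite mulrDl -E subrK.
Qed.

(** With an integral equation of degree [N] for [f / g], the element [g ^+ N] is a common
    denominator of all powers of [f / g], which is therefore almost integral over the cone
    algebra. *)
Lemma integral_closure_cone (A : {poly S} -> Prop) (u : {fraction {poly S}}) :
  included A cone_alg -> integral_closure A u ->
  exists2 q, cone_alg q & u = q%:F.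
Proof.
move=> AB [[f [g [Af [Ag [g0 ->]]]]] [p [pm [pA rp]]]].
set u0 := _ / _ in rp *; set N := (size p).-1.
have gF0 : g%:F != 0 by rewrite tofrac_eq0.
have fuE : f%:F = u0 * g%:F by rewrite divfK.
clearbody u0.
have uN : u0 ^+ N = - \sum_(i < N) p`_i * u0 ^+ i.
  apply/eqP; rewrite -addr_eq0 addrC; move: rp; rewrite rootE horner_coef.
  have -> : size p = N.+1.
    by rewrite prednK // lt0n size_poly_eq0 monic_neq0.
  rewrite big_ord_recr /= -[p`_N]/(lead_coef p) (monicP pm) mul1r.
  by rewrite addrC.
have step k : exists2 q, cone_alg q & (g ^+ N)%:F * u0 ^+ k = q%:F.
  have [k'] := ubnP k; elim: k' k => // k' IH k; rewrite ltnS => hk.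
  have [kN|Nk] := ltnP k N.
    exists (g ^+ (N - k) * f ^+ k).
      by apply: cone_algM; apply: cone_algX; apply: AB.
    rewrite tofracM !tofracXn fuE -{1}(subnK (ltnW kN)) exprD.
    by rewrite exprMn -mulrA [X in _ * X]mulrC.
  (* For [k >= N] the integral equation replaces [u0 ^+ k] by lower powers, for which the induction
     hypothesis provides elements of the cone algebra. *)
  have sumE (P : pred 'I_N) : exists2 q, cone_alg q &
      \sum_(i | P i) (g ^+ N)%:F * (p`_i * u0 ^+ (i + (k - N))) = q%:F.
    apply: (big_ind (fun x => exists2 q, cone_alg q & x = q%:F))
      => [|x y [q1 h1 ->] [q2 h2 ->]|i _].
    - by exists 0; rewrite ?tofrac0 //; apply: cone_alg0.
    - by exists (q1 + q2); rewrite ?tofracD //; apply: cone_algD.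
    have [q1 hq1 E1] := pA i.
    have [|q2 hq2 E2] := IH (i + (k - N))%N.
      by apply: leq_trans hk; have := ltn_ord i; lia.
    exists (q1 * q2); first by apply: cone_algM => //; apply: AB.
    by rewrite E1 mulrCA E2 tofracM.
  have [q hq E] := sumE predT; exists (- q); first exact: cone_algN.
  rewrite -(subnKC Nk) exprD uN mulNr mulrN tofracN -E mulr_suml mulr_sumr.
  by congr (- _); apply: eq_bigr => i _; rewrite exprD !mulrA.
have [|q hq E] := cone_almost_integral_dvd (expf_neq0 N g0) g0 (f := f).
  move=> k; have [q hq E] := step k; exists q => //.
  apply/eqP; rewrite -tofrac_eq; apply/eqP.
  by rewrite !tofracM -E !tofracXn fuE exprMn mulrA.
by exists q => //; apply: (mulIf gF0); rewrite -fuE E tofracM.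
Qed.

End ConeAlgebra.

(** * Powers of irreducible ideals *)

Section IdealPowers.
Import Order.TTheory GRing.Theory.
Local Open Scope ring_scope.
Variables (R : comNzRingType).
Implicit Types (J : R -> Prop).

Lemma ideal_gen_incl (G : R -> Prop) f : G f -> ideal_gen G f.
Proof.
move=> Gf; exists 1%N, (fun _ => 1), (fun _ => f); split=> //; split=> //.
by rewrite big_ord1 mul1r.
Qed.

Lemma ideal_genM (G : R -> Prop) c f : ideal_gen G f -> ideal_gen G (c * f).
Proof.
case=> [s [d [g [_ [Gg ->]]]]]; exists s, (fun i => c * d i), g.
by split=> //; split=> //; rewrite mulr_sumr; apply: eq_bigr => i _; rewrite mulrA.
Qed.

Lemma ideal_gen0 (G : R -> Prop) : ideal_gen G 0.
Proof.
exists 0%N, (fun _ => 0), (fun _ => 0).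
by split=> //; split=> [[]//|]; rewrite big_ord0.
Qed.

Lemma ideal_genD (G : R -> Prop) f g :
  ideal_gen G f -> ideal_gen G g -> ideal_gen G (f + g).
Proof.
case=> [s [c [x [_ [Gx ->]]]]] [t [d [y [_ [Gy ->]]]]].
exists (s + t)%N, (fun i => match split i with inl j => c j | inr j => d j end),
  (fun i => match split i with inl j => x j | inr j => y j end).
split=> //; split=> [i|]; first by case: (split i).
rewrite big_split_ord /=; congr (_ + _); apply: eq_bigr => i _.
  by rewrite (unsplitK (inl i)).
by rewrite (unsplitK (inr i)).
Qed.

Lemma ideal_pow0 J f : ideal_pow J 0 f.
Proof.
rewrite -[f]mulr1; apply/ideal_genM/ideal_gen_incl; exists (fun _ => 0).
by split=> [[]//|]; rewrite big_ord0.
Qed.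

Lemma ideal_pow_mono J J' k f :
  included J J' -> ideal_pow J k f -> ideal_pow J' k f.
Proof.
move=> JJ' [s [d [g [_ [Gg ->]]]]]; exists s, d, g; split=> //; split=> // i.
by have [g' [hg' ->]] := Gg i; exists g'; split=> // j; apply: JJ'.
Qed.

Lemma prod_ordS J k x (g : 'I_k -> R) : J x -> (forall i, J (g i)) ->
  exists g' : 'I_k.+1 -> R,
    (forall i, J (g' i)) /\ x * \prod_(i < k) g i = \prod_(i < k.+1) g' i.
Proof.
move=> Jx Jg; exists (fun i => oapp g x (unlift ord0 i)); split.
  by move=> i; case: unlift.
rewrite big_ord_recl unlift_none /=; congr (_ * _).
by apply: eq_bigr => i _; rewrite liftK.
Qed.

End IdealPowers.

(** * Monomials in irreducible ideals and their powers *)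

Section IrreducibleIdeals.
Import Order.TTheory GRing.Theory.
Local Open Scope ring_scope.
Variables (K : fieldType) (n : nat).
Local Notation S := {mpoly K[n]}.
Implicit Types (a u v w : 'X_{1..n}) (f : S).

(* The condition [\sum_i u_i / a_i >= k] over the support of [a] becomes
   [\sum_i facet_coef a i * u_i >= facet_const a * k]. *)
Definition facet_coef a i :=
  (if a i == 0 then 0 else \prod_(j | j != i) maxn (a j) 1)%N.
Definition facet_const a := (\prod_j maxn (a j) 1)%N.

Lemma facet_const_gt0 a : (0 < facet_const a)%N.
Proof. by apply: prodn_gt0 => j; rewrite leq_max orbT. Qed.

Lemma facet_coefE a i : a i != 0%N -> (facet_coef a i * a i)%N = facet_const a.
Proof.
move=> ai; rewrite /facet_coef (negPf ai) /facet_const [RHS](bigD1 i) //=.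
by rewrite mulnC (maxn_idPl _) // lt0n.
Qed.

(** The product omits the index [i], hence the exponent [n - 1]; positivity of [d] covers the
    factors 1 outside the support. *)
Lemma facet_coef_le a i d :
  (forall j, a j <= d)%N -> (0 < d)%N -> (facet_coef a i <= d ^ (n - 1))%N.
Proof.
move=> ad d0; rewrite /facet_coef; case: ifP => // _.
have -> : (d ^ (n - 1) = \prod_(j | j != i) d)%N.
  rewrite prod_nat_const; congr (_ ^ _)%N.
  by rewrite (cardC1 i) card_ord subn1.
by apply: leq_prod => j _; rewrite geq_max ad.
Qed.

Lemma irreducible_idealX a i (e : 'X_{1..n}) :
  a i != 0%N -> (a i <= e i)%N -> irreducible_ideal a ('X_[e] : S).
Proof.
move=> ai aei; have -> : 'X_[e] = 'X_[(e - U_(i) *+ a i)] * 'X_i ^+ a i :> S.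
  rewrite mpolyXn -mpolyXD submK //; apply/mnm_lepP => j.
  by rewrite mulmnE mnm1E; case: eqP => [<-|]; rewrite ?mul1n ?mul0n.
by apply/ideal_genM/ideal_gen_incl; exists i.
Qed.

Lemma irreducible_ideal_supp a f u : irreducible_ideal a f -> u \in msupp f ->
  exists2 i, a i != 0%N & (a i <= u i)%N.
Proof.
case=> [s [d [g [_ [Gg ->]]]]] /msupp_sum_le /flattenP [t /mapP [j _ ->]].
have [i ai ->] := Gg j; rewrite mpolyXn => /msuppM_le /allpairsP.
case=> [[v w] /= [_]]; rewrite msuppX inE => /eqP -> ->; exists i => //.
by rewrite mnmDE mulmnE mnm1E eqxx mul1n leq_addl.
Qed.

Definition facet_weight a u := (\sum_i facet_coef a i * u i)%N.

Lemma facet_weightD a : {morph facet_weight a : u v / (u + v)%MM >-> (u + v)%N}.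
Proof. exact: (@weightD n 1 (fun _ => facet_coef a) ord0). Qed.

Lemma irreducible_ideal_order a f :
  irreducible_ideal a f -> order_ge (facet_weight a) (facet_const a) f.
Proof.
move=> hf; apply/order_geP => u /(irreducible_ideal_supp hf) [i ai aui].
rewrite /facet_weight (bigD1 i) //= -(facet_coefE ai).
by apply: leq_trans (leq_addr _ _); rewrite leq_mul2l aui orbT.
Qed.

Lemma ideal_pow_order a k f : ideal_pow (irreducible_ideal a) k f ->
  order_ge (facet_weight a) (facet_const a * k) f.
Proof.
case=> [s [d [g [_ [Gg ->]]]]]; apply: order_ge_sum => i _.
rewrite -[X in order_ge _ X]add0n; apply: order_geM; first exact: facet_weightD.
  exact/order_geP.
have {Gg} [g' [Jg ->]] := Gg i; elim: k g' Jg {i g} => [|k IH] g Jg.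
  by rewrite muln0; apply/order_geP.
rewrite big_ord_recl mulnS; apply: order_geM; first exact: facet_weightD.
  exact: irreducible_ideal_order.
exact: IH.
Qed.

(** Here [e i] counts the copies of the generator [x_i^(a i)] available in [x^u]; the induction
    splits off one copy at a time until [k] are used. *)
Lemma ideal_pow_monomial a k u (e : 'I_n -> nat) :
  (k <= \sum_(i | a i != 0) e i)%N ->
  (forall i, a i != 0 -> e i * a i <= u i)%N ->
  ideal_pow (irreducible_ideal a) k ('X_[u] : S).
Proof.
move=> ke eu.
suff [h [g [Jg ->]]] : exists h (g : 'I_k -> S),
    (forall i, irreducible_ideal a (g i)) /\ 'X_[u] = h * \prod_i g i.
  by apply/ideal_genM/ideal_gen_incl; exists g.
elim: k u e ke eu => [|k IH] u e ke eu.
  exists 'X_[u], (fun _ => 0); split=> [[]//|]; by rewrite big_ord0 mulr1.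
have [i ai ei] : exists2 i, a i != 0%N & (0 < e i)%N.
  apply/exists_inP; apply: contraTT ke => /exists_inPn h.
  by rewrite big1 // => i /h; rewrite -leqNgt leqn0 => /eqP.
pose v : 'X_{1..n} := (u - U_(i) *+ a i)%MM.
have le : (U_(i) *+ a i <= u)%MM.
  apply/mnm_lepP => j; rewrite mulmnE mnm1E; case: eqP => [<-|]; rewrite ?mul1n ?mul0n //.
  by apply: leq_trans (eu i ai); rewrite leq_pmull.
have [||h [g [Jg E]]] := IH v (fun j => e j - (j == i))%N.
- rewrite (bigD1 i) //= eqxx; move: ke; rewrite (bigD1 i) //=.
  have -> : (\sum_(j | (a j != 0) && (j != i)) (e j - (j == i))
      = \sum_(j | (a j != 0) && (j != i)) e j)%N.
    by apply: eq_bigr => j /andP[_ /negPf ->]; rewrite subn0.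
  by move: (\sum_(_ | _) _)%N => x; lia.
- move=> j aj; rewrite mnmBE mulmnE mnm1E eq_sym.
  have := eu j aj; case: eqP => [->|_]; last by rewrite mul0n !subn0.
  by rewrite mul1n mulnBl mul1n => h; apply: leq_sub2r.
have Jx : irreducible_ideal a ('X_i ^+ a i : S) by apply: ideal_gen_incl; exists i.
have [g' [Jg' E']] := prod_ordS Jx Jg; exists h, g'; split=> //.
by rewrite -E' mulrCA -E mpolyXn -mpolyXD addmC submK.
Qed.

(* The least common multiple of generators of the [b j] avoiding [a] lies in
   the intersection. *)
Lemma bigcap_irreducible_sub a s (b : 'I_s -> 'X_{1..n}) :
  (forall f, (forall j, irreducible_ideal (b j) f) -> irreducible_ideal a f) ->
  exists j, included (@irreducible_ideal K n (b j)) (irreducible_ideal a).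
Proof.
move=> H.
(* [bad j i] marks a generator of the [j]-th ideal, a power of [x_i], that lies outside the ideal of
   [a]. *)
pose bad (j : 'I_s) i := (b j i != 0%N) && ~~ ((a i != 0%N) && (a i <= b j i)%N).
have [j jP|H'] := pickP (fun j => [forall i, ~~ bad j i]).
  exists j => f [t [d [g [_ [Gg ->]]]]].
  have Gg' i : irreducible_ideal a (g i).
    have [i' bi' ->] := Gg i.
    move/forallP/(_ i'): jP; rewrite /bad bi' /= negbK => /andP[ai' le].
    rewrite mpolyXn; apply: (@irreducible_idealX _ i') => //.
    by rewrite mulmnE mnm1E eqxx mul1n.
  elim/big_rec: _ => [|i x _ IHx]; first exact: ideal_gen0.
  exact: (ideal_genD (ideal_genM _ (Gg' i)) IHx).
pose e : 'X_{1..n} := [multinom \max_(j < s | bad j i) b j i | i < n].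
have /irreducible_ideal_supp/(_ (_ : e \in _)) : irreducible_ideal a ('X_[e] : S).
  apply: H => j; move: (H' j) => /forallPn [i]; rewrite negbK => bji.
  apply: (@irreducible_idealX _ i); first by case/andP: bji.
  by rewrite mnmE; apply: (@leq_bigmax_cond _ (bad^~ i) (fun j => b j i)).
case; first by rewrite msuppX inE.
move=> i ai; rewrite mnmE leqNgt => /negP; case.
rewrite -(prednK (_ : 0 < a i)%N) ?lt0n // ltnS; apply/bigmax_leqP => j.
by case/andP => _; rewrite ai /= -ltnNge; move: ai; case: (a i).
Qed.

End IrreducibleIdeals.

(** * The symbolic algebra *)

Section SymbolicAlgebra.
Import Order.TTheory GRing.Theory.
Local Open Scope ring_scope.
Local Notation "x %:F" := (tofrac x).
Variables (K : fieldType) (n m : nat) (I : {mpoly K[n]} -> Prop).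
Variable (a : 'I_m -> 'X_{1..n}).
Hypothesis a_neq0 : forall l, a l != 0%MM.
Hypothesis I_dec : canonical_decomposition I a.
Local Notation S := {mpoly K[n]}.
Local Notation coefs := (fun l => facet_coef (a l)).
Local Notation consts := (fun l => facet_const (a l)).

(** The presentation [b] behind a membership may differ from [a], but each component of [a] contains
    some irreducible component of [b], hence the corresponding primary component. *)
Lemma symbolic_algebra_cone : included (symbolic_algebra I) (cone_alg coefs consts).
Proof.
move=> p Ip l k; have [s [b [[bI _] hb]]] := Ip k.
have [|j jl] := @bigcap_irreducible_sub K n (a l) s b.
  by move=> f /bI; have [[aI _] _] := I_dec => /aI.
apply: ideal_pow_order; apply: ideal_pow_mono (hb j) => f /(_ j) hf.
exact/jl/hf.
Qed.

(** Since the radicals are pairwise distinct, each primary component of the presentation [a] is a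
    single irreducible ideal. *)
Lemma symbolic_power_intro k (f : S) :
  (forall l, ideal_pow (irreducible_ideal (a l)) k f) -> symbolic_power I k f.
Proof.
have [pres rad] := I_dec => hf; exists m, a; split=> // j.
apply: ideal_pow_mono (hf j) => g hg j' rj.
by have [->//|/rad] := eqVneq j' j.
Qed.

Lemma symbolic_algebraZXn (s : S) k :
  symbolic_power I k s -> symbolic_algebra I (s *: 'X^k).
Proof.
move=> hs j; rewrite coefZ coefXn; case: eqP => [->|_]; first by rewrite mulr1.
rewrite mulr0; apply: symbolic_power_intro => l; exact: ideal_gen0.
Qed.

Lemma symbolic_algebraN p : symbolic_algebra I p -> symbolic_algebra I (- p).
Proof.
move=> hp k; have [s [b [bI hb]]] := hp k; exists s, b; split=> // j.
by rewrite coefN -mulN1r; apply: ideal_genM (hb j).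
Qed.

Lemma symbolic_algebraC (s : S) : symbolic_algebra I s%:P.
Proof.
have -> : s%:P = s *: 'X^0 by rewrite expr0 alg_polyC.
by apply/symbolic_algebraZXn/symbolic_power_intro => l; apply: ideal_pow0.
Qed.

Lemma fraction_field_monomial k (u : 'X_{1..n}) :
  fraction_field_of (symbolic_algebra I) ('X_[u] *: 'X^k : {poly S})%:F.
Proof.
(* The exponent is at least [k * a l i] for every [l], so multiplication by [x^v] puts any monomial
   into all the [k]-th powers. *)
pose v : 'X_{1..n} := [multinom (k * \sum_l a l i)%N | i < n].
have v0 : ('X_[v] : S)%:P != 0 by rewrite polyC_eq0 -msupp_eq0 msuppX.
exists ('X_[u + v] *: 'X^k), ('X_[v])%:P; split.
  apply/symbolic_algebraZXn/symbolic_power_intro => l.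
  apply: (@ideal_pow_monomial _ _ _ _ _ (fun _ => k)) => [|i ai].
    have [i ai|a0] := pickP (fun i => a l i != 0%N).
      by rewrite (bigD1 i) //= leq_addr.
    case/negP: (a_neq0 l); apply/eqP/mnmP => i; rewrite mnm0E.
    by move/negbFE/eqP: (a0 i).
  rewrite mnmDE mnmE; apply: leq_trans (leq_addl _ _).
  by rewrite leq_mul2l (bigD1 l) //= leq_addr orbT.
split; first exact: symbolic_algebraC.
split=> //; rewrite mpolyXD; apply: (canRL (mulfK _)).
  by rewrite tofrac_eq0.
by rewrite -tofracM -scalerA -scalerAl mulrC mul_polyC !scalerA mulrC.
Qed.

Lemma symbolic_algebra_cone_pow k (u : 'X_{1..n}) : in_cone coefs consts k u ->
  exists2 M, (0 < M)%N & symbolic_algebra I (('X_[u] *: 'X^k) ^+ M).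
Proof.
(* [M] is a common multiple of all nonzero [a l i], so the quotients [M * u i %/ a l i] below are
   exact and count the generators in [x^(M u)]. *)
move=> hu; pose M := (\prod_l facet_const (a l))%N.
exists M; first by apply: prodn_gt0 => l; apply: facet_const_gt0.
rewrite exprZn -exprM mpolyXn; apply/symbolic_algebraZXn/symbolic_power_intro => l.
have aM i : a l i != 0%N -> (a l i %| M * u i)%N.
  move=> ai; apply: dvdn_mulr; rewrite /M (bigD1 l) //= dvdn_mulr //.
  by rewrite -(facet_coefE ai) dvdn_mull.
apply: (@ideal_pow_monomial _ _ _ _ _ (fun i => M * u i %/ a l i)%N) => [|i ai].
  rewrite -(leq_pmul2l (facet_const_gt0 (a l))) mulnA.
  apply: leq_trans (leq_mul (hu l) (leqnn M)) _.
  rewrite big_distrl big_distrr /= [X in (_ <= X)%N]big_mkcond /=.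
  apply: leq_sum => i _; case: ifP => [ai|/negbFE/eqP ai].
    by rewrite -(facet_coefE ai) -!mulnA (mulnC (a l i)) divnK ?aM // (mulnC M).
  by rewrite /facet_coef ai.
by rewrite divnK ?aM // mulmnE mulnC.
Qed.

(** Some positive power [x ^+ M] lies in the symbolic algebra, so the monomial is a root of
    [X^M - x^M]. *)
Lemma cone_monomial_integral k (u : 'X_{1..n}) : in_cone coefs consts k u ->
  integral_closure (symbolic_algebra I) ('X_[u] *: 'X^k : {poly S})%:F.
Proof.
move=> hu; split; first exact: fraction_field_monomial.
have [M M0 hM] := symbolic_algebra_cone_pow hu.
set x := _ *: _ in hM *; exists ('X^M - ((x ^+ M)%:F)%:P); split.
  exact: monicXnsubC.
split=> [i|].
  rewrite coefB coefXn coefC.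
  exists ((i == M)%:R%:P - (if i == 0%N then x ^+ M else 0)).
    case: (i =P 0%N) => [->|_]; last by rewrite subr0; apply: symbolic_algebraC.
    by rewrite eq_sym -leqn0 leqNgt M0 polyC0 sub0r; apply: symbolic_algebraN.
  by rewrite tofracB; case: eqP; case: eqP; rewrite ?tofrac0 ?tofrac1.
by rewrite rootE hornerD hornerN hornerC hornerXn tofracXn subrr.
Qed.

Lemma integral_closure_generated d :
  (0 < d)%N -> (0 < n)%N -> (forall l i, a l i <= d)%N ->
  generated_in_degree (integral_closure (symbolic_algebra I))
    ((n.+1)`! %/ 2 * (d ^ (n - 1)) ^ n).
Proof.
move=> d0 n0 ad x hx B Bc BG BD BM.
have B0 : B 0 by have := Bc 0; rewrite tofrac0.
(* Strong induction on the degree in [t]: a monomial above the bound is a product of two cone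
   monomials of smaller degree. *)
have Bmon k (u : 'X_{1..n}) : in_cone coefs consts k u ->
    B ('X_[u] *: 'X^k : {poly S})%:F.
  have [k'] := ubnP k; elim: k' k u => // k' IH k u; rewrite ltnS => kk' hu.
  have [kD|Dk] := leqP k ((n.+1)`! %/ 2 * (d ^ (n - 1)) ^ n).
    apply: BG; split; first exact: cone_monomial_integral.
    by exists k => //; exists 'X_[u].
  have E0 : (0 < d ^ (n - 1))%N by rewrite expn_gt0 d0.
  have [|k1 [v [w [/andP[k10 k1k] uvw hv hw]]]] :=
    cone_decomposition n0 E0 _ hu Dk.
    by move=> l i; apply: facet_coef_le.
  pose mv : 'X_{1..n} := [multinom v i | i < n].
  pose mw : 'X_{1..n} := [multinom w i | i < n].
  have -> : 'X_[u] *: 'X^k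
      = ('X_[mv] *: 'X^k1) * ('X_[mw] *: 'X^(k - k1)) :> {poly S}.
    rewrite -scalerAl -scalerAr scalerA -mpolyXD -exprD subnKC ?(ltnW k1k) //.
    by congr ('X_[_] *: _); apply/mnmP => i; rewrite mnmDE !mnmE.
  rewrite tofracM; apply: BM; apply: IH; try lia.
    by move=> l; under eq_bigr => i _ do rewrite mnmE; apply: hv.
  by move=> l; under eq_bigr => i _ do rewrite mnmE; apply: hw.
(* An arbitrary element of the closure is a polynomial in the cone algebra, hence a combination of
   cone monomials with constant coefficients. *)
have [q hq ->] := integral_closure_cone symbolic_algebra_cone hx.
rewrite -[q]coefK poly_def rmorph_sum /=.
elim/big_ind: _ => // k _; rewrite {1}[q`_k]mpolyE scaler_suml rmorph_sum /=.
rewrite big_seq; elim/big_ind: _ => // u uq.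
have -> : (q`_k)@_u *: 'X_[u] *: 'X^k
    = (((q`_k)@_u)%:MP)%:P * ('X_[u] *: 'X^k) :> {poly S}.
  by rewrite mul_polyC scalerA mul_mpolyC.
rewrite tofracM; apply: BM; first exact: Bc.
by apply: Bmon => l; move/order_geP: (hq l k); apply.
Qed.

End SymbolicAlgebra.

(** * The least generating degree and its bound *)

Lemma generation_degree_exists (R : idomainType) (A : {fraction {poly R}} -> Prop) D :
  generated_in_degree A D ->
  exists2 D', is_generation_degree A D' & (D' <= D)%N.
Proof.
elim/ltn_ind: D => D IH gD.
(* Generation in a given degree is not decidable, so the descent to the least degree uses excluded
   middle. *)
have [[D' [lt gD']]|no] := classic (exists D', D' < D /\ generated_in_degree A D').
  by have [D'' h le] := IH _ lt gD'; exists D'' => //; apply: leq_trans le (ltnW lt).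
exists D => //; split=> // D' gD'; rewrite leqNgt; apply/negP => lt.
by apply: no; exists D'.
Qed.

Theorem theorem4p2 (K : fieldType) (n m : nat)
    (I : {mpoly K[n]} -> Prop) (a : 'I_m -> 'X_{1..n})
    (m_gt0 : 0 < m)
    (a_neq0 : forall l, a l != 0%MM)
    (I_monomial : monomial_ideal I)
    (I_gci : generically_ci I)
    (I_dec : canonical_decomposition I a) :
  let d := \max_(l < m) \max_(i < n) a l i in
  exists D : nat,
    is_generation_degree (integral_closure (symbolic_algebra I)) D /\
    D <= (n.+1)`! %/ 2 * d ^ (n * (n - 1)).
Proof.
move=> d; have ad l i : a l i <= d.
  apply: (@leq_trans (\max_(i < n) a l i)).
    exact: (@leq_bigmax _ (fun i => a l i)).
  exact: (@leq_bigmax _ (fun l => \max_(i < n) a l i)).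
(* A nonzero coordinate of the first vector makes both [d] and [n] positive. *)
have [i ai] : exists i, 0 < a (Ordinal m_gt0) i.
  apply/existsP; apply: contraR (a_neq0 (Ordinal m_gt0)) => /existsPn h.
  by apply/eqP/mnmP => i; rewrite mnm0E; apply/eqP; rewrite -leqn0 leqNgt h.
have d0 : 0 < d by apply: leq_trans ai (ad _ _).
have n0 : 0 < n by apply: leq_ltn_trans (ltn_ord i).
have := integral_closure_generated a_neq0 I_dec d0 n0 ad.
by rewrite -expnM (mulnC _ n) => /generation_degree_exists [D]; exists D.
Qed.
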